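(* Let $X$ be an ultrahomogeneous LOTS and $G=(\mathrm{Aut}\,X,\tau_p)$. There are no sm-compactifications of $G$. Moreover, the WAP-compactification of $G$ is trivial.
   Context: $X$ is an infinite linearly ordered set with the order topology (LOTS), ultrahomogeneous: for every $n$ and all $x_1<\dots<x_n$, $y_1<\dots<y_n$ in $X$ there is an order automorphism $g\in\mathrm{Aut}\,X$ with $g(x_i)=y_i$. $\tau_p$ is the topology of pointwise convergence on $\mathrm{Aut}\,X$ (subbase $\{g\mid gx\in O\}$, $x\in X$, $O\subset X$ open), which is a group topology. A (proper) compactification of $G$ is a compact Hausdorff space with a dense topological embedding of $G$. An sm-compactification of $G$ is a compactification $bG$ to which the action of $G$ on itself by left multiplication extends continuously and which carries a separately continuous monoid multiplication $\bullet$ (a semitopological monoid) with $g\bullet h=gh$ for $g,h\in G$. The WAP-compactification of $G$ is the maximal (not necessarily proper) semitopological semigroup compactification: a compact Hausdorff semitopological monoid $W$ with a continuous homomorphism $w:G\to W$ with dense image through which every continuous homomorphism of $G$ into a compact Hausdorff semitopological semigroup factors. It is trivial if $W$ is a one-point set. *)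

(* Defs.v *)
From HB Require Import structures.
From mathcomp Require Import all_boot all_order.
From mathcomp Require Import all_classical topology.

Set Implicit Arguments.
Unset Strict Implicit.
Unset Printing Implicit Defensive.

Local Open Scope classical_set_scope.
Local Open Scope group_scope.

(* As for PreTopologicalNmodule in the library, the Pre structures are mere joins:
   no continuity of the operations is required. *)
#[short(type="preTopologicalSemigroupType")]
HB.structure Definition PreTopologicalSemigroup :=
  {S of Topological S & Semigroup S}.

#[short(type="preTopologicalMonoidType")]
HB.structure Definition PreTopologicalMonoid := {S of Topological S & Monoid S}.

#[short(type="preTopologicalGroupType")]
HB.structure Definition PreTopologicalGroup := {G of Topological G & Group G}.

HB.mixin Record PreTopologicalSemigroup_isSemitopological S
    & PreTopologicalSemigroup S := {
  mulg_continuousr : forall a : S, continuous (fun x : S => a * x);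
  mulg_continuousl : forall a : S, continuous (fun x : S => x * a)
}.

#[short(type="semitopologicalSemigroupType")]
HB.structure Definition SemitopologicalSemigroup :=
  {S of PreTopologicalSemigroup S & PreTopologicalSemigroup_isSemitopological S}.

#[short(type="semitopologicalMonoidType")]
HB.structure Definition SemitopologicalMonoid :=
  {S of SemitopologicalSemigroup S & Monoid S}.

(* The inverse is carried as data, but it is determined by the map: see
   [order_aut_eq]. *)
Record order_aut {d} (X : porderType d) := OrderAut {
  aut_fun :> X -> X;
  aut_inv : X -> X;
  aut_funK : cancel aut_fun aut_inv;
  aut_invK : cancel aut_inv aut_fun;
  aut_mono : {mono aut_fun : x y / (x <= y)%O}
}.

Lemma order_aut_eq {d} (X : porderType d) (g h : order_aut X) :
  g =1 h -> g = h.
Proof.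
case: g h => [f f' fK f'K fm] [k k' kK k'K km] /= /funext fk.
subst k; have f'k' : f' = k' by apply/funext => y; rewrite -{1}(k'K y) fK.
by subst k'; congr OrderAut; exact: Prop_irrelevance.
Qed.

HB.instance Definition _ {d} (X : porderType d) := gen_eqMixin (order_aut X).
HB.instance Definition _ {d} (X : porderType d) := gen_choiceMixin (order_aut X).

Section order_aut_group.
Context {d} {X : porderType d}.
Implicit Types g h k : order_aut X.

Definition order_aut_one : order_aut X :=
  @OrderAut d X idfun idfun (frefl _) (frefl _) (fun _ _ => erefl).

Definition order_aut_mul g h : order_aut X :=
  @OrderAut d X (g \o h) (aut_inv h \o aut_inv g)
    (can_comp (aut_funK g) (aut_funK h)) (can_comp (aut_invK h) (aut_invK g))
    (fun x y => etrans (aut_mono g (h x) (h y)) (aut_mono h x y)).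

Definition order_aut_inv g : order_aut X :=
  @OrderAut d X (aut_inv g) g (aut_invK g) (aut_funK g)
    (can_mono (aut_invK g) (aut_mono g)).

Let mulA : associative order_aut_mul.
Proof. by move=> g h k; exact: order_aut_eq. Qed.

Let mul1 : left_id order_aut_one order_aut_mul.
Proof. by move=> g; exact: order_aut_eq. Qed.

Let mulr1 : right_id order_aut_one order_aut_mul.
Proof. by move=> g; exact: order_aut_eq. Qed.

Let mulV : left_inverse order_aut_one order_aut_inv order_aut_mul.
Proof. by move=> g; apply: order_aut_eq => x; exact: aut_funK. Qed.

Let mulrV : right_inverse order_aut_one order_aut_inv order_aut_mul.
Proof. by move=> g; apply: order_aut_eq => x; exact: aut_invK. Qed.

HB.instance Definition _ :=
  isGroup.Build (order_aut X) mulA mul1 mulr1 mulV mulrV.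

End order_aut_group.

(* Topology of pointwise convergence, inherited from {ptws X -> X}, where X has
   its order topology. *)
Definition aut_ptws {d} {X : orderTopologicalType d} (g : order_aut X) :
  {ptws X -> X} := g.

HB.instance Definition _ {d} (X : orderTopologicalType d) :=
  Topological.copy (order_aut X) (initial_topology (@aut_ptws d X)).

Definition ultrahomogeneous {d} (X : porderType d) : Prop :=
  forall (n : nat) (x y : 'I_n -> X),
    {homo x : i j / (i < j)%N >-> (i < j)%O} ->
    {homo y : i j / (i < j)%N >-> (i < j)%O} ->
    exists g : order_aut X, forall i, g (x i) = y i.

Definition topological_embedding {S T : topologicalType} (f : S -> T) : Prop :=
  [/\ continuous f, injective f &
      forall U : set S, open U ->
        exists2 V : set T, open V & f @` U = V `&` range f].

Definition compactification {S K : topologicalType} (b : S -> K) : Prop :=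
  [/\ compact [set: K], hausdorff_space K, topological_embedding b &
      dense (range b)].

Definition left_translation_extends {G : preTopologicalGroupType}
    {K : topologicalType} (b : G -> K) : Prop :=
  exists act : G -> K -> K,
    [/\ continuous (fun p : G * K => act p.1 p.2),
        forall x, act 1 x = x,
        forall g h x, act (g * h) x = act g (act h x) &
        forall g h, act g (b h) = b (g * h)].

Definition sm_compactification {G : preTopologicalGroupType}
    {K : semitopologicalMonoidType} (b : G -> K) : Prop :=
  [/\ compactification b, left_translation_extends b &
      forall g h, b g * b h = b (g * h)].

Record wap_compactification {G : preTopologicalGroupType}
    {W : semitopologicalMonoidType} (w : G -> W) : Prop := {
  wap_compact : compact [set: W];
  wap_hausdorff : hausdorff_space W;
  wap_continuous : continuous w;
  wap_one : w 1 = 1;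
  wap_mul : {morph w : g h / g * h};
  wap_dense : dense (range w);
  wap_universal : forall (S : semitopologicalSemigroupType) (f : G -> S),
    compact [set: S] -> hausdorff_space S ->
    continuous f -> {morph f : g h / g * h} ->
    exists phi : W -> S,
      [/\ continuous phi, {morph phi : x y / x * y} & f =1 phi \o w]
}.

(* The first conjunct makes sure that the second one is not vacuous. *)
Definition wap_trivial (G : preTopologicalGroupType) : Prop :=
  (exists (W : semitopologicalMonoidType) (w : G -> W),
     wap_compactification w) /\
  (forall (W : semitopologicalMonoidType) (w : G -> W),
     wap_compactification w -> exists p : W, [set: W] = [set p]).

(* Main.v *)
Require Import Defs.
From HB Require Import structures.
From mathcomp Require Import all_boot all_order interval all_classical topology.
From mathcomp Require Import zify.

Set Implicit Arguments.
Unset Strict Implicit.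
Unset Printing Implicit Defensive.
Import Order.TTheory.
Local Open Scope classical_set_scope.
Local Open Scope group_scope.

(** It suffices that every continuous homomorphism [f] from [Aut X] to a compact
    Hausdorff semitopological semigroup [S] is constant. For an order-convex [I]
    without endpoints, let [G_I] be the group of automorphisms supported in [I].
    Automorphisms pushing more and more of [I] to its right end conjugate every
    element of [G_I] with bounded support into smaller and smaller final pieces
    of [I], and a cluster point [e_I] of their images is a zero of the closure
    of [f(G_I)]; this needs a weak form of joint continuity in [S], which is
    forced by the infinite products of automorphisms with disjoint supports.
    If [b] is in [I], let [e] be the product of the zeros attached to the two
    halves of [I] cut at [b]. Every [g] in [G_I] moving [b] is, up to left and
    right factors fixing [b], an automorphism arbitrarily close to [1], so that
    [e f(g) e = e]; hence [e = e_I]. Cutting at finitely many points, the zero of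
    [f(Aut X)] lies in the closure of the image of every pointwise stabiliser of
    a finite set, so it is [f(1)]. *)

(** * Compactness, closures and separation *)

Lemma compact_directed (T : topologicalType) (I : Type) (D : I -> set T) :
  compact [set: T] -> inhabited I -> (forall i, D i !=set0) ->
  (forall i j, exists k, D k `<=` D i `&` D j) ->
  exists x, forall i, closure (D i) x.
Proof.
move=> cT [i0] D0 Ddir.
have FF : ProperFilter (filter_from [set: I] D).
  apply: filter_from_proper => [|i _]; last exact: D0.
  apply: filter_from_filter => [|i j _ _]; first by exists i0.
  by have [k kij] := Ddir i j; exists k.
have [|x [_ clx]] := cT _ FF; first exact: filterT.
by exists x => i B; apply: clx; exists i.
Qed.

Lemma filter_forall_seq (T : Type) (I : eqType) (F : set_system T) (s : seq I)
    (P : I -> set T) :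
  Filter F -> (forall i, i \in s -> F (P i)) ->
  F [set t | forall i, i \in s -> P i t].
Proof.
move=> FF; elim: s => [|i s IHs] FP; first by apply: filterS filterT.
have FPi : F (P i) by apply: FP; rewrite mem_head.
have FPs : F [set t | forall j, j \in s -> P j t].
  by apply: IHs => j js; apply: FP; rewrite inE js orbT.
by apply: filterS (filterI FPi FPs) => t [Pi Ps] j /[!inE] /predU1P[->|/Ps].
Qed.

Lemma nbhs_preimage (T U : topologicalType) (phi : T -> U) (a : T) (O : set U) :
  continuous phi -> open O -> O (phi a) -> nbhs a [set b | O (phi b)].
Proof. by move=> cphi oO Oa; exact: (cphi a _ (open_nbhs_nbhs (conj oO Oa))). Qed.

Lemma regular_open_nbhs (T : topologicalType) (x : T) (N : set T) :
  {for x, regular_space T} -> open N -> N x ->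
  exists O : set T, [/\ open O, O x & closure O `<=` N].
Proof.
move=> regx oN Nx; have /regx[B Bx BN] : nbhs x N by exact: open_nbhs_nbhs.
exists B°; split; [exact: open_interior|exact: nbhs_singleton (nbhs_interior Bx)|].
by apply: subset_trans BN; apply: closureS; exact: interior_subset.
Qed.

(** The layers of closures are those that [cantor_separation] consumes: two successive limits on the
    side of [x2], one on the side of [x1]. *)
Lemma separating_opens (S : topologicalType) (x1 x2 : S) :
  compact [set: S] -> hausdorff_space S -> x1 <> x2 ->
  exists O1 O2 N1 N2 W : set S,
    [/\ O1 x1 /\ O2 x2,
        [/\ open O1, open O2, open N1, open N2 & open W],
        closure O1 `<=` N1, closure O2 `<=` W /\ closure W `<=` N2 &
        N1 `&` N2 = set0].
Proof.
move=> S_compact S_hausdorff; have regS (x : S) : {for x, regular_space S}.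
  exact: (compact_regular S_hausdorff S_compact filterT).
move=> x12; move: S_hausdorff; rewrite open_hausdorff => /(_ x1 x2).
case; first exact/eqP.
move=> [N1 N2] /= [/set_mem x1N /set_mem x2N] [oN1 oN2 /eqP N12].
have [O1 [oO1 x1O O1N]] := regular_open_nbhs (regS x1) oN1 x1N.
have [W [oW x2W WN]] := regular_open_nbhs (regS x2) oN2 x2N.
have [O2 [oO2 x2O O2W]] := regular_open_nbhs (regS x2) oW x2W.
by exists O1, O2, N1, N2, W.
Qed.

Lemma closure_image (S T : topologicalType) (A : set S) (C : set T) (phi : S -> T)
    (a : S) :
  continuous phi ->
  closure A a -> (forall b, A b -> closure C (phi b)) -> closure C (phi a).
Proof.
move=> cphi Aa AC B /nbhs_interior /cphi /Aa[b [Ab Bb]].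
exact: AC Ab _ Bb.
Qed.

(** This carries identities in a semitopological semigroup to limits one variable at a time, so that
    separate continuity suffices. *)
Lemma closure_eq_fun (S T : topologicalType) (A : set S) (phi psi : S -> T) (a : S) :
  compact [set: T] -> hausdorff_space T -> continuous phi ->
  continuous psi -> closure A a ->
  (forall b, A b -> phi b = psi b) -> phi a = psi a.
Proof.
move=> cT hT cphi cpsi Aa Aeq; apply: contrapT => /(separating_opens cT hT).
move=> [O1 [O2 [N1 [N2 [W [[O1a O2a] [oO1 oO2 _ _ _] O1N [O2W WN] N12]]]]]].
have [b [Ab [O1b O2b]]] := Aa _ (filterI
  (nbhs_preimage cphi oO1 O1a) (nbhs_preimage cpsi oO2 O2a)).
have : (N1 `&` N2) (phi b).
  split; first by apply: O1N; exact: subset_closure.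
  by apply: WN; apply: subset_closure; apply: O2W; rewrite Aeq//; exact: subset_closure.
by rewrite N12.
Qed.

(** As [n] varies, the sequences [B] with [prefix_eq n A B] form the basic neighbourhoods of [A] in
    the Cantor space. *)
Definition prefix_eq (n : nat) (A B : nat -> bool) :=
  forall i, i < n -> A i = B i.

Definition truncate (A : nat -> bool) (n : nat) : nat -> bool :=
  fun i => (i < n) && A i.

Definition add_index (A : nat -> bool) (i : nat) : nat -> bool :=
  fun j => (j == i) || A j.

(** * Separately continuous maps on the Cantor space *)

Section CantorSeparation.
Variables (T S : topologicalType) (Phi : (nat -> bool) -> T -> S).
Hypothesis T_compact : compact [set: T].
Hypothesis Phi_continuous : forall A, continuous (Phi A).
Hypothesis Phi_prefix : forall A t O, open O -> O (Phi A t) ->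
  exists n, forall B, prefix_eq n A B -> O (Phi B t).

(* For each [A] let [t'] be a limit of the points [t] given by later and later
   indices [i]: such a [t] is not separated from [t'] by [N1] and [N2] at the
   truncations of [A] so far, but the jump to [O1] does separate them. Iterating along a growing [A] and passing to a
   limit of the pairs [(t, t')], the two points are not separated at any truncation
   of the limiting [A] but are separated at [A] itself. *)
Lemma cantor_separation (O1 O2 N1 N2 W : set S) :
  open O1 -> open O2 -> open N1 -> open N2 -> open W ->
  closure O1 `<=` N1 -> closure O2 `<=` W -> closure W `<=` N2 ->
  N1 `&` N2 = set0 ->
  ~ (forall A n, (forall i, n <= i -> A i = false) ->
       exists i t, [/\ n <= i, O2 (Phi A t) & O1 (Phi (add_index A i) t)]).
Proof.
move=> oO1 oO2 oN1 oN2 oW O1N1 O2W WN2 N12 jump.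
have PhiO A U : open U -> open (Phi A @^-1` U).
  by move=> oU; apply: open_comp => // t _; exact: Phi_continuous.
(* A stage is a length and a sequence. The pair [u] is separated by [O1] and [W] at every sequence
   with the prefix of [s'], but not by [N1] and [N2] at truncations of [s.2] to at most [s.1]
   bits. *)
pose R (s s' : nat * (nat -> bool)) (u : T * T) := [/\ s.1 < s'.1,
  (forall i, s'.1 <= i -> s'.2 i = false), prefix_eq s.1 s.2 s'.2,
  (forall B, prefix_eq s'.1 s'.2 B -> O1 (Phi B u.1) /\ W (Phi B u.2)) &
  forall m, m <= s.1 ->
    ~ (N1 (Phi (truncate s.2 m) u.1) /\ N2 (Phi (truncate s.2 m) u.2))].
have step s : (forall i, s.1 <= i -> s.2 i = false) -> exists s' u, R s s' u.
  case: s => n A /= Asupp.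
  pose D m := [set t | exists i,
    [/\ m <= i, O2 (Phi A t) & O1 (Phi (add_index A i) t)]].
  have D_anti m m' : m <= m' -> D m' `<=` D m.
    by move=> mm' t [i [mi ? ?]]; exists i; split => //; exact: leq_trans mi.
  have [t' t'D] : exists t', forall m, closure (D (maxn n m)) t'.
    apply: compact_directed => // [m|m m'].
      have [i|i [t [ni O2t O1t]]] := jump A (maxn n m).
        by rewrite geq_max => /andP[/Asupp].
      by exists t, i.
    by exists (maxn m m') => t Dt; split; apply: D_anti Dt; lia.
  have WAt' : W (Phi A t').
    apply: O2W => B.
    by move=> /(@Phi_continuous A t') /(t'D 0)[t [[i [_ ? _]] ?]]; exists (Phi A t).
  have [n1 n1W] := Phi_prefix oW WAt'.
  (* Finitely many truncations matter, so [t] can be so near [t'] that [N2] at [t'] gives [N2] at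
     [t], which excludes [N1] at [t]. Taking [i] at least [n1] keeps the prefix that forces [W] at
     [t']. *)
  have [t [t_trunc [i [ni _ O1t]]]] : exists t,
      (forall m, m <= n -> N2 (Phi (truncate A m) t') -> N2 (Phi (truncate A m) t)) /\
      D (maxn n n1) t.
    suff : nbhs t' [set t | forall m, m \in iota 0 n.+1 ->
        N2 (Phi (truncate A m) t') -> N2 (Phi (truncate A m) t)].
      move=> /(t'D n1)[t [Dt tN]]; exists t; split=> // m mn.
      by apply: tN; rewrite mem_iota.
    apply: filter_forall_seq => m _.
    have [N2m|nN2m] := pselect (N2 (Phi (truncate A m) t')).
      apply: filterS (open_nbhs_nbhs (conj (PhiO (truncate A m) _ oN2) N2m)).
      by move=> t.
    by apply: filterS filterT => t _ /nN2m.
  have [n2 n2O] := Phi_prefix oO1 O1t.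
  (* [n2] bits secure [O1] at [t]; the new sequence vanishes from [i.+1] on, and [i.+1] exceeds
     [n]. *)
  exists (maxn n2 i.+1, add_index A i), (t, t'); split => /=.
  - lia.
  - by move=> j; rewrite geq_max => /andP[_ ij]; rewrite /add_index Asupp; lia.
  - by move=> j jn; rewrite /add_index (_ : j == i = false)//; lia.
  - move=> B AB; split; first by apply: n2O => j jn; apply: AB; lia.
    apply: n1W => j jn; have ji : j < i.
      by apply: leq_trans jn _; apply: leq_trans ni; exact: leq_maxr.
    by rewrite -AB /add_index ?ltn_eqF// leq_max ltnS (ltnW ji) orbT.
  - move=> m mn [N1t /(t_trunc m mn) N2t].
    by have : (N1 `&` N2) (Phi (truncate A m) t) by []; rewrite N12.
pose state := {s : nat * (nat -> bool) | forall i, s.1 <= i -> s.2 i = false}.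
have /choice[next nextP] (s : state) : exists su : state * (T * T),
    R (sval s) (sval su.1) su.2.
  case: s => s ssupp; have [s' [u Ru]] := step s ssupp.
  have [_ s'supp _ _ _] := Ru.
  by exists (exist _ s' s'supp, u).
have s0 : state by exists (0, fun=> false).
pose s_ j := iter j (fun s => (next s).1) s0.
pose n_ j := (sval (s_ j)).1; pose A_ j := (sval (s_ j)).2.
pose u_ j := (next (s_ j)).2.
have sP j : R (n_ j, A_ j) (n_ j.+1, A_ j.+1) (u_ j).
  rewrite /n_ /A_ -!surjective_pairing /=; exact: nextP.
have n_mono j k : j <= k -> n_ j <= n_ k /\ prefix_eq (n_ j) (A_ j) (A_ k).
  elim: k => [|k IHk]; first by rewrite leqn0 => /eqP ->.
  rewrite leq_eqVlt => /predU1P[->//|/IHk[njk Ajk]].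
  have [/= nk _ Ak _ _] := sP k; split; first lia.
  by move=> i ij; rewrite Ajk// Ak//; lia.
have n_ge j : j <= n_ j.
  by elim: j => // j IHj; have [/= + _ _ _ _] := sP j; lia.
(* Bit [i] is frozen from stage [i.+1] on, since [n_ j] is at least [j]. *)
pose A i := A_ i.+1 i.
have A_prefix j : prefix_eq (n_ j) (A_ j) A.
  move=> i ij; rewrite /A; have [ji|ij'] := leqP j i.+1.
    by have [_ ->] := n_mono _ _ ji.
  by have [_ ->//] := n_mono _ _ (ltnW ij'); exact: n_ge.
have [[t t'] tt'P] : exists u : T * T, forall j,
    closure [set u_ k | k in [set k | j <= k]] u.
  apply: compact_directed => // [||j|j k].
  - rewrite -setXTT; exact: compact_setX.
  - exact: inhabits 0.
  - by exists (u_ j), j => /=.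
  - exists (maxn j k) => _ [i /= + <-]; rewrite geq_max => /andP[ji ki].
    by split; exists i.
have uA j : O1 (Phi A (u_ j).1) /\ W (Phi A (u_ j).2).
  by have [_ _ _ + _] := sP j; apply; exact: A_prefix.
have N1t : N1 (Phi A t).
  apply: O1N1 => B /(@Phi_continuous A t) Bt.
  have [_ [[k _ <-] Bk]] : [set u_ k | k in [set k | 0 <= k]] `&`
      (fun u : T * T => B (Phi A u.1)) !=set0.
    apply: (tt'P 0 (fun u : T * T => B (Phi A u.1))).
    by exists (Phi A @^-1` B, setT); [split=> //; exact: filterT|case=> a b []].
  by exists (Phi A (u_ k).1); split=> //; case: (uA k).
have N2t' : N2 (Phi A t').
  apply: WN2 => B /(@Phi_continuous A t') Bt.
  have [_ [[k _ <-] Bk]] : [set u_ k | k in [set k | 0 <= k]] `&`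
      (fun u : T * T => B (Phi A u.2)) !=set0.
    apply: (tt'P 0 (fun u : T * T => B (Phi A u.2))).
    by exists (setT, Phi A @^-1` B); [split=> //; exact: filterT|case=> a b []].
  by exists (Phi A (u_ k).2); split=> //; case: (uA k).
have [m1 m1N1] := Phi_prefix oN1 N1t; have [m2 m2N2] := Phi_prefix oN2 N2t'.
(* With [m] bits of [A], [N1] at [t] and [N2] at [t'] still hold, hence also at some pair [u_ k]
   with [k] at least [m], against the last clause of [R]. *)
pose m := maxn m1 m2.
have N1m : N1 (Phi (truncate A m) t).
  by apply: m1N1 => i im; rewrite /truncate (_ : i < m) //; lia.
have N2m : N2 (Phi (truncate A m) t').
  by apply: m2N2 => i im; rewrite /truncate (_ : i < m) //; lia.
have [_ [[k /= mk <-] [N1k N2k]]] : [set u_ k | k in [set k | m <= k]] `&`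
    ((fun u : T * T => N1 (Phi (truncate A m) u.1)) `&`
     (fun u : T * T => N2 (Phi (truncate A m) u.2))) !=set0.
  apply: (tt'P m ((fun u : T * T => N1 (Phi (truncate A m) u.1)) `&`
     (fun u : T * T => N2 (Phi (truncate A m) u.2)))).
  exists (Phi (truncate A m) @^-1` N1, Phi (truncate A m) @^-1` N2) => //.
  by split; apply: open_nbhs_nbhs; split => //; exact: PhiO.
have Ak_trunc : truncate (A_ k) m = truncate A m.
  apply/funext => i; rewrite /truncate; case: ltnP => //= im.
  by rewrite (A_prefix k)//; exact: leq_trans (leq_trans im mk) (n_ge k).
have [_ _ _ _ /(_ m)] := sP k; rewrite /= Ak_trunc; apply => //.
exact: leq_trans (n_ge k).
Qed.
End CantorSeparation.

(** * Order automorphisms *)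

Section OrderAut.
Context {d : Order.disp_t} {X : orderType d}.
Implicit Types (g h k : order_aut X) (x y l r : X) (A B : set X).

Lemma autK g : cancel g (g^-1)%g.
Proof. exact: aut_funK. Qed.

Lemma autVK g : cancel (g^-1)%g g.
Proof. exact: aut_invK. Qed.

Lemma aut_le g x y : (g x <= g y)%O = (x <= y)%O.
Proof. exact: aut_mono. Qed.

Lemma aut_lt g x y : (g x < g y)%O = (x < y)%O.
Proof. by rewrite !ltNge aut_le. Qed.

Definition supported A g := forall x, ~ A x -> g x = x.

Lemma supported1 A : supported A 1.
Proof. by []. Qed.

Lemma supported_mem A g x : supported A g -> A x -> A (g x).
Proof.
move=> Ag Ax; apply: contrapT => nAgx.
have gx : g x = x by rewrite -[LHS](autK g) (Ag _ nAgx) autK.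
by apply: nAgx; rewrite gx.
Qed.

Lemma supportedM A g h : supported A g -> supported A h -> supported A (g * h).
Proof.
by move=> Ag Ah x nAx; rewrite -[(g * h) x]/(g (h x)) Ah// Ag.
Qed.

Lemma supportedV A g : supported A g -> supported A g^-1.
Proof. by move=> Ag x nAx; rewrite -{1}(Ag _ nAx) autK. Qed.

Lemma supportedS A B g : A `<=` B -> supported A g -> supported B g.
Proof. by move=> AB Ag x nBx; apply: Ag => /AB. Qed.

Definition oo l r : set X := [set x | (l < x < r)%O].

Lemma supported_conj g h l r :
  supported (oo l r) h -> supported (oo (g l) (g r)) (g * h * g^-1).
Proof.
move=> lrh x nx; rewrite -[(g * h * g^-1) x]/(g (h (g^-1 x))) lrh ?autVK//.
by move=> xlr; apply: nx; rewrite -(autVK g x) /oo /= !aut_lt.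
Qed.

Lemma order_aut_glue g h c : g c = h c -> exists k,
  (forall x, (x <= c)%O -> k x = g x) /\ (forall x, (c <= x)%O -> k x = h x).
Proof.
move=> gch.
pose f x := if (x <= c)%O then g x else h x.
pose f' x := if (x <= g c)%O then g^-1 x else h^-1 x.
have fK : cancel f f'.
  move=> x; rewrite /f /f'; have [xc|cx] := leP x c.
    by rewrite aut_le xc autK.
  by rewrite gch aut_le leNgt cx autK.
have f'K : cancel f' f.
  move=> x; rewrite /f /f'; have [xc|cx] := leP x (g c).
    by rewrite -(aut_le g) autVK xc.
  by rewrite -(aut_le h _ c) autVK -gch leNgt cx.
have f_mono : {mono f : x y / (x <= y)%O}.
  apply: le_mono => x y xy; rewrite /f.
  have [xc|cx] := leP x c; have [yc|cy] := leP y c; rewrite ?aut_lt//.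
    by apply: (@le_lt_trans _ _ (g c)); rewrite ?aut_le// gch aut_lt.
  by move: (lt_trans cx xy); rewrite ltNge yc.
exists (OrderAut fK f'K f_mono); split => x /= xc; rewrite /f; first by rewrite xc.
by case: leP => // cx; rewrite (@le_anti _ _ x c) ?cx// gch.
Qed.

Section Sum.
Variables (I : Type) (l r : I -> X).
Hypothesis disj : forall i j, i <> j -> (r i <= l j)%O \/ (r j <= l i)%O.

Lemma oo_inj i j x : oo (l i) (r i) x -> oo (l j) (r j) x -> i = j.
Proof.
move=> /andP[lix xri] /andP[ljx xrj]; apply: contrapT => /disj[] le.
  by move: (lt_trans xri (le_lt_trans le ljx)); rewrite ltxx.
by move: (lt_trans xrj (le_lt_trans le lix)); rewrite ltxx.
Qed.

Let f (v : I -> order_aut X) x : X :=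
  if pselect (exists i, oo (l i) (r i) x) is left e then v (sval (cid e)) x else x.

Let f_in (v : I -> order_aut X) i x : oo (l i) (r i) x -> f v x = v i x.
Proof.
move=> xi; rewrite /f; case: pselect => [e|[]]; last by exists i.
by case: cid => j /= xj; rewrite (oo_inj xi xj).
Qed.

Let f_out (v : I -> order_aut X) x : (forall i, ~ oo (l i) (r i) x) -> f v x = x.
Proof. by move=> xn; rewrite /f; case: pselect => // -[i xi]; case: (xn i). Qed.

(** Each [v i] preserves its own interval, so disjointness keeps the order between the pieces, and
    the inverses [(v i)^-1] assemble to the inverse. *)
Lemma order_aut_sum (v : I -> order_aut X) :
  (forall i, supported (oo (l i) (r i)) (v i)) -> exists k,
  (forall i x, oo (l i) (r i) x -> k x = v i x) /\
  (forall x, (forall i, ~ oo (l i) (r i) x) -> k x = x).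
Proof.
move=> vi.
have fK w : (forall i, supported (oo (l i) (r i)) (w i)) ->
    cancel (f w) (f (fun i => (w i)^-1)).
  move=> wi x; have [[i xi]|/forallNP nx] := pselect (exists i, oo (l i) (r i) x).
    rewrite (f_in _ xi) (@f_in _ i) ?autK//; exact: supported_mem.
  by rewrite !f_out.
have f_mono : {mono f v : x y / (x <= y)%O}.
  apply: le_mono => x y xy.
  have f_mem i z : oo (l i) (r i) (f v z) -> oo (l i) (r i) z.
    have [[j zj]|/forallNP nz] := pselect (exists i, oo (l i) (r i) z); last first.
      by rewrite f_out.
    rewrite (f_in _ zj) => vzi.
    by rewrite -(oo_inj (supported_mem (vi j) zj) vzi).
  have [[i xi]|/forallNP nx] := pselect (exists i, oo (l i) (r i) x).
    rewrite (f_in _ xi); have [yi|nyi] := pselect (oo (l i) (r i) y).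
      by rewrite (f_in _ yi) aut_lt.
    have /andP[_ vxr] := supported_mem (vi i) xi; apply: lt_le_trans vxr _.
    have ry : (r i <= y)%O.
      rewrite leNgt; apply/negP => yr; apply: nyi; rewrite /oo /= yr andbT.
      by have /andP[lx _] := xi; exact: lt_trans xy.
    have [[j yj]|/forallNP ny] := pselect (exists i, oo (l i) (r i) y); last first.
      by rewrite f_out.
    rewrite (f_in _ yj); have /andP[lv _] := supported_mem (vi j) yj.
    have [|rl|rl] := @disj i j; first by move=> ij; apply: nyi; rewrite ij.
      exact: ltW (le_lt_trans rl lv).
    have /andP[_ yr] := yj; have /andP[lx _] := xi.
    by move: (lt_trans (lt_le_trans (lt_trans xy yr) rl) lx); rewrite ltxx.
  rewrite f_out//; have [[i yi]|/forallNP ny] := pselect (exists i, oo (l i) (r i) y).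
    rewrite (f_in _ yi); have /andP[lv _] := supported_mem (vi i) yi.
    apply: le_lt_trans lv; rewrite leNgt; apply/negP => lx; apply: (nx i).
    by rewrite /oo /= lx; have /andP[_ yr] := yi; exact: lt_trans yr.
  by rewrite f_out.
have f'K : cancel (f (fun i => (v i)^-1)) (f v).
  have -> : v = fun i => ((v i)^-1)^-1 by apply/funext => i; rewrite invgK.
  by under [X in f X]eq_fun do rewrite invgK; apply: fK => i; exact: supportedV.
exists (OrderAut (fK v vi) f'K f_mono); split => [i x|x] /=.
  exact: f_in.
exact: f_out.
Qed.

End Sum.

Lemma monotone_disjoint (l r : nat -> X) :
  (forall i, (l i <= r i)%O) -> (forall i, (r i <= l i.+1)%O) ->
  forall i j, i <> j -> (r i <= l j)%O \/ (r j <= l i)%O.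
Proof.
move=> lr rl; have rlt i j : i < j -> (r i <= l j)%O.
  elim: j => // j IHj; rewrite ltnS leq_eqVlt => /predU1P[->//|/IHj rlj].
  exact: le_trans rlj (le_trans (lr j) (rl j)).
by move=> i j /eqP; rewrite neq_ltn => /orP[/rlt|/rlt]; [left|right].
Qed.

Lemma antitone_disjoint (l r : nat -> X) :
  (forall i, (l i <= r i)%O) -> (forall i, (r i.+1 <= l i)%O) ->
  forall i j, i <> j -> (r i <= l j)%O \/ (r j <= l i)%O.
Proof.
move=> lr rl; have rlt i j : i < j -> (r j <= l i)%O.
  elim: j => // j IHj; rewrite ltnS leq_eqVlt => /predU1P[->//|/IHj rlj].
  exact: le_trans (rl j) (le_trans (lr j) rlj).
by move=> i j /eqP; rewrite neq_ltn => /orP[/rlt|/rlt]; [right|left].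
Qed.
End OrderAut.

(** * The topology of pointwise convergence *)

Section PointwiseTopology.
Context {d : Order.disp_t} {X : orderTopologicalType d}.
Implicit Types (g h : order_aut X).

Lemma order_aut_cvg (F : set_system (order_aut X)) g : Filter F ->
  (forall x, (fun h => h x) @ F --> g x) -> F --> g.
Proof.
move=> FF Fg V [U [[O oO OU] Ug UV]].
have : aut_ptws @ F --> aut_ptws g.
  apply/cvg_sup => x A [B [[C oC <-] Cgx CA]].
  have := Fg x C (open_nbhs_nbhs (conj oC Cgx)).
  exact: (@filterS _ F _ _ _ (fun h => CA (aut_ptws h))).
move=> /(_ O); rewrite -OU in Ug UV.
move=> /(_ (open_nbhs_nbhs (conj oO Ug))).
exact: (@filterS _ F _ _ _ UV).
Qed.

(** Agreement with [g] on ever larger finite sets implies pointwise convergence to [g]. *)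
Lemma order_aut_nbhs_seq g V : nbhs g V ->
  exists s : seq X, forall h, (forall x, x \in s -> h x = g x) -> V h.
Proof.
pose F := filter_from [set: seq X]
  (fun s : seq X => [set h : order_aut X | forall x, x \in s -> h x = g x]).
have FF : Filter F.
  apply: filter_from_filter; first by exists [::].
  move=> s t _ _; exists (s ++ t) => // h hst.
  by split=> x xs; apply: hst; rewrite mem_cat xs ?orbT.
have : F --> g.
  apply: order_aut_cvg => x B /nbhs_singleton Bx.
  by exists [:: x] => // h /(_ x); rewrite /= mem_head => ->.
by move=> /[apply] -[s _ sV]; exists s.
Qed.
End PointwiseTopology.

(** * Ultrahomogeneous linear orders *)

Section Homogeneous.
Context {d : Order.disp_t} {X : orderTopologicalType d}.
Hypothesis X_infinite : infinite_set [set: X].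
Hypothesis X_uh : ultrahomogeneous X.
Implicit Types (g h k : order_aut X) (x y l r : X) (I : set X).

Lemma uh_seq (s t : seq X) : sorted <%O s -> sorted <%O t -> size s = size t ->
  exists g : order_aut X, map g s = t.
Proof.
case: s t => [|x s] [|y t] // ss st sst; first by exists 1.
pose a (i : 'I_(size s).+1) := nth x (x :: s) i.
pose b (i : 'I_(size s).+1) := nth x (y :: t) i.
have [i j ij|i j ij|g gP] := X_uh (x := a) (y := b).
- by apply: (sorted_ltn_nth lt_trans x ss) => //; rewrite inE ltn_ord.
- by apply: (sorted_ltn_nth lt_trans x st) => //; rewrite inE -sst ltn_ord.
exists g; apply: (@eq_from_nth _ x); rewrite size_map// => i ilt.
by rewrite (nth_map x)//; exact: (gP (Ordinal ilt)).
Qed.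

Lemma exists_lt : exists x y : X, (x < y)%O.
Proof.
apply: contrapT => nlt; apply: X_infinite.
have [x _] := infinite_setN0 X_infinite.
apply: sub_finite_set (finite_set1 x) => y _ /=.
by have [xy|yx|->] := ltgtP x y => //; case: nlt; [exists x, y|exists y, x].
Qed.

Lemma uh_gt x : exists y, (x < y)%O.
Proof.
have [a [b ab]] := exists_lt.
have [//|//|//|g [<-]] := @uh_seq [:: a] [:: x].
by exists (g b); rewrite aut_lt.
Qed.

Lemma uh_lt x : exists y, (y < x)%O.
Proof.
have [a [b ab]] := exists_lt.
have [//|//|//|g [<-]] := @uh_seq [:: b] [:: x].
by exists (g a); rewrite aut_lt.
Qed.

Lemma uh_dense x y : (x < y)%O -> exists z, (x < z < y)%O.
Proof.
move=> xy; have [a [b ab]] := exists_lt; have [c bc] := uh_gt b.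
have [||//|g [<- <-]] := @uh_seq [:: a; c] [:: x; y].
- by rewrite /= (lt_trans ab bc).
- by rewrite /= xy.
by exists (g b); rewrite !aut_lt ab.
Qed.

(** An automorphism fixing [l] and [r] and taking [x] to [y] is glued with the identity at both
    ends. *)
Lemma supported_transitive l r x y : (l < x < r)%O -> (l < y < r)%O ->
  exists2 g : order_aut X, supported (oo l r) g & g x = y.
Proof.
move=> /andP[lx xr] /andP[ly yr].
have [||//|g [gl gx gr]] := @uh_seq [:: l; x; r] [:: l; y; r].
- by rewrite /= lx xr.
- by rewrite /= ly yr.
have [k [kl kr]] := @order_aut_glue _ _ 1 g l (esym gl).
have [k' [k'l k'r]] : exists k' : order_aut X,
    (forall z, (z <= r)%O -> k' z = k z) /\ (forall z, (r <= z)%O -> k' z = z).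
  by apply: (@order_aut_glue _ _ k 1); rewrite kr ?gr// ltW// (lt_trans lx).
exists k'; last by rewrite k'l ?kr ?gx// ltW.
move=> z zlr; have [zl|lz] := leP z l.
  by rewrite k'l ?kl// (le_trans zl)// ltW// (lt_trans lx).
by rewrite k'r// leNgt; apply/negP => zr; apply: zlr; rewrite /oo /= lz.
Qed.

(** Sets rather than pairs of end points: [X] itself and the pieces cut off by a point must be
    covered, and their ends may be missing from [X]. *)
Definition open_convex I := [/\ I !=set0,
  (forall x y z, I x -> I z -> (x <= y <= z)%O -> I y),
  (forall x, I x -> exists2 y, I y & (y < x)%O) &
  (forall x, I x -> exists2 y, I y & (x < y)%O)].

Lemma open_convexT : open_convex [set: X].
Proof.
have [a _] := exists_lt; split=> [|//|x _|x _]; first by exists a.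
  by have [y] := uh_lt x; exists y.
by have [y] := uh_gt x; exists y.
Qed.

Definition below I x := I `&` [set y | (y < x)%O].
Definition above I x := I `&` [set y | (x < y)%O].

Lemma open_convex_below I x : open_convex I -> I x -> open_convex (below I x).
Proof.
move=> [_ Ic Il Ir] Ix; split.
- by have [y] := Il _ Ix; exists y.
- move=> a b c [Ia ax] [Ic' cx] /andP[ab bc]; split; last exact: le_lt_trans cx.
  by apply: Ic Ia Ic' _; rewrite ab.
- move=> y [Iy yx]; have [z Iz zy] := Il _ Iy; exists z => //; split => //.
  exact: lt_trans yx.
- move=> y [Iy yx]; have [z /andP[yz zx]] := uh_dense yx; exists z => //.
  by split => //; apply: Ic Iy Ix _; rewrite !ltW.
Qed.

Lemma open_convex_above I x : open_convex I -> I x -> open_convex (above I x).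
Proof.
move=> [_ Ic Il Ir] Ix; split.
- by have [y] := Ir _ Ix; exists y.
- move=> a b c [Ia xa] [Ic' xc] /andP[ab bc]; split; last exact: lt_le_trans ab.
  by apply: Ic Ia Ic' _; rewrite ab.
- move=> y [Iy xy]; have [z /andP[xz zy]] := uh_dense xy; exists z => //.
  by split => //; apply: Ic Ix Iy _; rewrite !ltW.
- move=> y [Iy xy]; have [z Iz yz] := Ir _ Iy; exists z => //; split => //.
  exact: lt_trans yz.
Qed.

Lemma open_convex_lt2 I x y : open_convex I -> I x -> I y ->
  exists2 l, I l & (l < x)%O /\ (l < y)%O.
Proof.
move=> [_ _ Il _] Ix Iy; have [xy|yx] := leP x y.
  by have [l] := Il _ Ix; exists l => //; split => //; exact: lt_le_trans xy.
by have [l] := Il _ Iy; exists l => //; split => //; exact: lt_trans yx.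
Qed.

Lemma open_convex_gt2 I x y : open_convex I -> I x -> I y ->
  exists2 r, I r & (x < r)%O /\ (y < r)%O.
Proof.
move=> [_ _ _ Ir] Ix Iy; have [xy|yx] := leP x y.
  by have [r] := Ir _ Iy; exists r => //; split => //; exact: le_lt_trans xy _.
by have [r] := Ir _ Ix; exists r => //; split => //; exact: lt_trans yx _.
Qed.

Lemma oo_sub I l r : open_convex I -> I l -> I r -> oo l r `<=` I.
Proof.
by move=> [_ Ic _ _] Il Ir x /andP[lx xr]; apply: Ic Il Ir _; rewrite !ltW.
Qed.

Lemma supported_push I x y : open_convex I -> I x -> I y ->
  exists2 g : order_aut X, supported I g & (y < g x)%O.
Proof.
move=> Io Ix Iy; have [l Il [lx ly]] := open_convex_lt2 Io Ix Iy.
have [z Iz [xz yz]] := open_convex_gt2 Io Ix Iy.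
have [r Ir [zr _]] := open_convex_gt2 Io Iz Iz.
have [||g glr gx] := @supported_transitive l r x z.
- by rewrite lx (lt_trans xz).
- by rewrite (lt_trans lx).
by exists g; [apply: supportedS glr; exact: oo_sub|rewrite gx].
Qed.

(** Left of [x] and right of [y], [h] is replaced by automorphisms of bounded support that agree
    with it at [x] and at [y] respectively. *)
Lemma supported_bounded_approx I h x y :
  open_convex I -> supported I h -> I x -> I y -> (x <= y)%O ->
  exists l r k, [/\ I l, I r, (l < r)%O, supported (oo l r) k &
    forall z, (x <= z <= y)%O -> k z = h z].
Proof.
move=> Io hI Ix Iy xy.
have Ihx := supported_mem hI Ix; have Ihy := supported_mem hI Iy.
have [l Il [lx lhx]] := open_convex_lt2 Io Ix Ihx.
have [m Im [xm hxm]] := open_convex_gt2 Io Ix Ihx.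
have [n In [ny nhy]] := open_convex_lt2 Io Iy Ihy.
have [r Ir [yr hyr]] := open_convex_gt2 Io Iy Ihy.
have [||g1 g1s g1x] := @supported_transitive l m x (h x); rewrite ?lx ?lhx//.
have [||g2 g2s g2y] := @supported_transitive n r y (h y); rewrite ?ny ?nhy//.
have [k1 [k1l k1r]] := order_aut_glue g1x.
have k1y : k1 y = g2 y by rewrite k1r ?g2y.
have [k [kl kr]] := order_aut_glue k1y.
exists l, r, k; split => //.
- by rewrite (lt_trans lx)// (le_lt_trans xy).
- move=> z zlr; have [zl|lz] := leP z l.
    have zx : (z <= x)%O by rewrite (le_trans zl)// ltW.
    rewrite kl ?(le_trans zx)// k1l// g1s// => /andP[lz _].
    by move: lz; rewrite ltNge zl.
  have rz : (r <= z)%O.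
    by rewrite leNgt; apply/negP => zr; apply: zlr; rewrite /oo /= lz.
  rewrite kr; last by rewrite ltW// (lt_le_trans yr).
  by rewrite g2s// => /andP[_]; rewrite ltNge rz.
- by move=> z /andP[xz zy]; rewrite kl// k1r.
Qed.

(** A neighbourhood can be controlled by finitely many points. Those in [I] lie between two elements
    of [I]; those outside are fixed by both [h] and [k]. *)
Lemma supported_bounded_dense I h V : open_convex I -> supported I h -> nbhs h V ->
  exists l r k, [/\ I l, I r, (l < r)%O, supported (oo l r) k & V k].
Proof.
move=> Io hI /order_aut_nbhs_seq[s sV].
have [x [y [Ix Iy xy sxy]]] : exists x y, [/\ I x, I y, (x <= y)%O &
    forall z, z \in s -> I z -> (x <= z <= y)%O].
  elim: s {sV} => [|z s [x [y [Ix Iy xy sxy]]]].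
    by have [[x Ix] _ _ _] := Io; exists x, x.
  have [Iz|nIz] := pselect (I z); last first.
    by exists x, y; split=> // w /[!inE] /predU1P[->//|]; exact: sxy.
  exists (Order.min x z), (Order.max y z); split.
  - by rewrite /Order.min; case: ifP.
  - by rewrite /Order.max; case: ifP.
  - by rewrite ge_min le_max xy.
  - move=> w /[!inE] /predU1P[-> _|ws Iw]; first by rewrite ge_min le_max !lexx !orbT.
    by have /andP[xw wy] := sxy _ ws Iw; rewrite ge_min le_max xw wy.
have [l [r [k [Il Ir lr klr kh]]]] := supported_bounded_approx Io hI Ix Iy xy.
exists l, r, k; split => //; apply: sV => z zs.
have [Iz|nIz] := pselect (I z); first exact: kh (sxy _ zs Iz).
by rewrite hI// klr// => /(oo_sub Io Il Ir).
Qed.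

Lemma order_nbhs_oo x (V : set X) : nbhs x V ->
  exists l r, (l < x < r)%O /\ oo l r `<=` V.
Proof.
have [a ax] := uh_lt x; have [b xb] := uh_gt x.
rewrite itv_nbhsE => -[[lo hi] [/= i_open xi] iV].
move: lo hi i_open xi iV => [[]l|[]] [[]r|[]]//= _; rewrite in_itv /= ?andbT => xi iV.
- by exists l, r; split=> // y ylr; apply: iV; rewrite /= in_itv.
- exists l, b; split; first by rewrite xi.
  by move=> y /andP[ly _]; apply: iV; rewrite /= in_itv /= ly.
- exists a, r; split; first by rewrite ax.
  by move=> y /andP[_ yr]; apply: iV; rewrite /= in_itv /=.
- by exists a, b; split; [rewrite ax|move=> y _; apply: iV; rewrite /= in_itv].
Qed.

(** An interval around [x] ending at [y] forces [y] to be fixed, and [x] stays in the interval. This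
    gives automorphisms near [1] that still move [x]. *)
Lemma order_aut_nbhs1_oo x (V : set (order_aut X)) : nbhs (1 : order_aut X) V ->
  exists l r, (l < x < r)%O /\ (forall k, supported (oo l r) k -> V k).
Proof.
pose F := filter_from [set lr : X * X | (lr.1 < x < lr.2)%O]
  (fun lr => [set k | supported (oo lr.1 lr.2) k]).
have FF : Filter F.
  apply: filter_from_filter.
    by have [a ax] := uh_lt x; have [b xb] := uh_gt x; exists (a, b); apply/andP.
  move=> [l r] [l' r'] /= /andP[lx xr] /andP[lx' xr'].
  exists (Order.max l l', Order.min r r') => /=.
    by rewrite gt_max lx lx' lt_min xr xr'.
  move=> k ks; split; apply: supportedS ks => z;
    by rewrite /oo /= gt_max lt_min => /andP[/andP[? ?] /andP[? ?]]; apply/andP.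
have : F --> (1 : order_aut X).
  apply: order_aut_cvg => y B /order_nbhs_oo[l [r [lyr lrB]]].
  have [xy|yx|xy] := ltgtP x y.
  - have [a ax] := uh_lt x; exists (a, y); first by rewrite /= ax.
    move=> k /= ks; rewrite ks; first exact: lrB.
    by rewrite /oo /= ltxx andbF.
  - have [b xb] := uh_gt x; exists (y, b); first by rewrite /= yx.
    move=> k /= ks; rewrite ks; first exact: lrB.
    by rewrite /oo /= ltxx.
  - by subst y; exists (l, r) => // k /= ks; apply: lrB; exact: supported_mem.
by move=> /[apply] -[[l r] lxr lrV]; exists l, r.
Qed.


(** * Homomorphisms to compact semitopological semigroups *)

Section Constant.
Variables (S : semitopologicalSemigroupType) (f : order_aut X -> S).
Hypotheses (S_compact : compact [set: S]) (S_hausdorff : hausdorff_space S).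
Hypotheses (f_continuous : continuous f) (fM : {morph f : g h / g * h}).

(* [act] is left or right multiplication. In either case [f] need only turn
   products of commuting automorphisms into iterated actions. *)
Section Oscillation.
Variable act : S -> S -> S.
Hypothesis act_continuousr : forall a : S, continuous (act a).
Hypothesis act_continuousl : forall x : S, continuous (act^~ x).
Hypothesis act_commute : forall g h (x : S), commute g h ->
  act (f g) (act (f h) x) = act (f (g * h)) x.

(* The subproducts [k A] of the [v i] form a Cantor set in the group, and
   [k A] with the factor [v i] added sends [act (f (k A)^-1) (t i)] to
   [act (f (v i)) (t i)]. *)
Lemma no_oscillation (x1 x2 : S) : x1 <> x2 ->
  exists O1 O2 : set S, [/\ open O1, open O2, O1 x1, O2 x2 &
    forall (v : nat -> order_aut X) (l r : nat -> X) (t : nat -> S),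
      (forall i j, i <> j -> (r i <= l j)%O \/ (r j <= l i)%O) ->
      (forall i, supported (oo (l i) (r i)) (v i)) ->
      (forall i, act (f 1) (t i) = t i) ->
      ~ (forall i, O1 (act (f (v i)) (t i)) /\ O2 (t i))].
Proof.
move=> /(separating_opens S_compact S_hausdorff)[O1 [O2 [N1 [N2 [W]]]]].
move=> [[x1O x2O] [oO1 oO2 oN1 oN2 oW] O1N1 [O2W WN2] N12]; exists O1, O2.
split=> // v l r t disj vs t1 vt.
have /choice[k kP] (A : nat -> bool) : exists k : order_aut X,
    (forall i x, oo (l i) (r i) x -> k x = if A i then v i x else x) /\
    (forall x, (forall i, ~ oo (l i) (r i) x) -> k x = x).
  have [|k [kin kout]] := @order_aut_sum _ _ _ l r disj
      (fun i => if A i then v i else 1).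
    by move=> i; case: (A i).
  by exists k; split=> // i x xi; rewrite (kin i)//; case: (A i).
(* A point lies in at most one interval, so [k A x] depends on at most one bit of [A]. *)
have k_prefix A x : exists n, forall B, prefix_eq n A B -> k B x = k A x.
  have [[i xi]|/forallNP nx] := pselect (exists i, oo (l i) (r i) x).
    exists i.+1 => B AB.
    by rewrite !(proj1 (kP _) i)// AB.
  by exists 0 => B _; rewrite !(proj2 (kP _)).
have k_add A i : A i = false ->
    k (add_index A i) = v i * k A /\ commute (v i) (k A).
  move=> Ai.
  have kAi x : oo (l i) (r i) x -> k A x = x by move=> /(proj1 (kP A)); rewrite Ai.
  have vk x : ~ oo (l i) (r i) x -> ~ oo (l i) (r i) (k A x).
    have [[j xj]|/forallNP nx] := pselect (exists j, oo (l j) (r j) x); last first.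
      by rewrite (proj2 (kP _)).
    have kxj : oo (l j) (r j) (k A x).
      rewrite (proj1 (kP _) j)//; case: (A j) => //; exact: supported_mem.
    by move=> nxi kxi; apply: nxi; rewrite -(oo_inj disj kxj kxi).
  split; apply: order_aut_eq => x; rewrite -?[(v i * k A) x]/(v i (k A x)).
    have [xi|nxi] := pselect (oo (l i) (r i) x).
      by rewrite (proj1 (kP _) i)// kAi// /add_index eqxx.
    rewrite (vs i); last exact: vk.
    have [[j xj]|/forallNP nx] := pselect (exists j, oo (l j) (r j) x); last first.
      by rewrite !(proj2 (kP _)).
    rewrite !(proj1 (kP _) j)// /add_index (_ : (j == i) = false)//.
    by apply/negP => /eqP ji; apply: nxi; rewrite -ji.
  rewrite -[(k A * v i) x]/(k A (v i x)).
  have [xi|nxi] := pselect (oo (l i) (r i) x).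
    rewrite !kAi//; exact: supported_mem.
  rewrite !(vs i)//; exact: vk.
refine (@cantor_separation S S (fun A (a : S) => act (f (k A)) a) S_compact _ _
  O1 O2 N1 N2 W oO1 oO2 oN1 oN2 oW O1N1 O2W WN2 N12 _) => [A|A a O oO OA|A n Asupp].
- exact: act_continuousr.
- have cont : {for k A, continuous (act^~ a \o f)}.
    by apply: continuous_comp; [exact: f_continuous|exact: act_continuousl].
  have := cont _ (open_nbhs_nbhs (conj oO OA)).
  move=> /order_aut_nbhs_seq[s sO].
  have [n nP] : exists n, forall B, prefix_eq n A B ->
      forall y, y \in s -> k B y = k A y.
    elim: s {sO} => [|y s [n nP]]; first by exists 0.
    have [m mP] := k_prefix A y; exists (maxn m n) => B AB z.
    rewrite inE => /predU1P[->|zs].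
      by apply: mP => i im; apply: AB; rewrite leq_max im.
    by apply: nP => // i ini; apply: AB; rewrite leq_max ini orbT.
  by exists n => B AB; apply: sO => y ys; exact: nP.
- exists n, (act (f (k A)^-1) (t n)).
  have [kA vkC] := k_add A n (Asupp n (leqnn n)).
  have [O1v O2t] := vt n; split=> //.
    (* [S] need not have a unit: cancelling [k A] leaves [f 1], which fixes [t n] by hypothesis. *)
    by rewrite act_commute ?mulgV ?t1//; exact: commuteV.
  rewrite act_commute kA ?mulgK//.
  by apply/commute_sym; apply: commuteM; apply/commute_sym;
     apply/commuteV => //; exact: commute_refl.
Qed.
End Oscillation.

(** * Zeros attached to order-convex sets *)

Let cont_mulr (a : S) : continuous (fun x : S => a * x).
Proof. exact: mulg_continuousr. Qed.

Let cont_mull (a : S) : continuous (fun x : S => x * a).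
Proof. exact: mulg_continuousl. Qed.

Let cont_cst (a : S) : continuous (fun _ : S => a).
Proof. by move=> x; exact: cvg_cst. Qed.

Lemma closure_mul (A B C : set (order_aut X)) (a b : S) :
  closure (f @` A) a -> closure (f @` B) b ->
  (forall g h, A g -> B h -> C (g * h)) -> closure (f @` C) (a * b).
Proof.
move=> Aa Bb ABC; apply: closure_image (@cont_mull b) Aa _ => _ [g Ag <-].
apply: closure_image (@cont_mulr (f g)) Bb _ => _ [h Bh <-].
by apply: subset_closure; exists (g * h); [exact: ABC|rewrite fM].
Qed.

(** Absorption is required of the images only; [zero_absorb] extends it to their closure. *)
Definition is_zero I (e : S) := closure (f @` [set g | supported I g]) e /\
  forall g, supported I g -> f g * e = e /\ e * f g = e.

Lemma zero_absorb I (e a : S) : is_zero I e ->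
  closure (f @` [set g | supported I g]) a -> a * e = e /\ e * a = e.
Proof.
move=> [_ ze] Ia; split.
- apply: (closure_eq_fun S_compact S_hausdorff
    (@cont_mull e) (@cont_cst e) Ia) => _ [g Ig <-].
  by have [] := ze g Ig.
- apply: (closure_eq_fun S_compact S_hausdorff
    (@cont_mulr e) (@cont_cst e) Ia) => _ [g Ig <-].
  by have [] := ze g Ig.
Qed.

Lemma zero_unique I (e e' : S) : is_zero I e -> is_zero I e' -> e = e'.
Proof.
move=> ze ze'; have [e'e _] := zero_absorb ze (proj1 ze').
by have [_ <-] := zero_absorb ze' (proj1 ze).
Qed.

Definition pushing I c y := [set g : order_aut X | supported I g /\ (y < g c)%O].

(* If [p f(h) <> p], the elements [g h g^-1], for a sequence of pushing [g], have
   disjoint supports and would contradict [no_oscillation]; for [f(h) p], conjugate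
   by the inverses. *)
Lemma exists_zero I : open_convex I -> exists e, is_zero I e.
Proof.
move=> Io; have [[a Ia] _ _ _] := Io.
(* [p] is a limit along automorphisms sending points [c] ever further left in [I] beyond points [y]
   ever further right. *)
have [p pP] : exists p, forall c y, I c -> I y -> closure (f @` pushing I c y) p.
  pose T := {cy : X * X | I cy.1 /\ I cy.2}.
  have [|[[c y] /= [Ic Iy]]|[[c y] /= [Ic Iy]] [[c' y'] /= [Ic' Iy']]|p pP] :=
    @compact_directed S T (fun t => f @` pushing I (sval t).1 (sval t).2) S_compact.
  - by exists; exists (a, a).
  - by have [g gI yg] := supported_push Io Ic Iy; exists (f g), g.
  - have Imin : I (Order.min c c') by rewrite /Order.min; case: ifP.
    have Imax : I (Order.max y y') by rewrite /Order.max; case: ifP.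
    exists (exist _ (Order.min c c', Order.max y y') (conj Imin Imax)).
    move=> _ [g [gI /= +] <-]; rewrite gt_max => /andP[yg y'g].
    split; exists g => //; split => //.
      by apply: lt_le_trans yg _; rewrite aut_le ge_min lexx.
    by apply: lt_le_trans y'g _; rewrite aut_le ge_min lexx orbT.
  - by exists p => c y Ic Iy; exact: (pP (exist _ (c, y) (conj Ic Iy))).
have pR h l r : I l -> I r -> (l < r)%O -> supported (oo l r) h -> p * f h = p.
  move=> Il Ir lr hlr; apply: contrapT => ph.
  have [|O1 [O2 [oO1 oO2 O1p O2p osc]]] :=
      no_oscillation (@cont_mulr) (@cont_mull) _ ph.
    by move=> g k b _; rewrite mulgA fM.
  have /choice[G GP] (y : {y | I y}) : exists g, [/\ supported I g,
      (sval y < g l)%O, O1 (f g * f h) & O2 (f g)].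
    case: y => y /= Iy; have [_ [[g [gI yg] <-] [O1g O2g]]] := pP l y Il Iy _
      (filterI (nbhs_preimage (@cont_mull (f h)) oO1 O1p)
               (open_nbhs_nbhs (conj oO2 O2p))).
    by exists g.
  have GI u : I (G u r) by apply: supported_mem => //; have [] := GP u.
  (* Each new [g] sends [l] beyond the image of [r] under its predecessor, so the supports of the
     conjugates follow one another to the right. Multiplying [f (g i)] on the left by the image of
     the conjugate gives [f (g i) * f h]. *)
  pose Y i := iter i (fun u => exist _ (G u r) (GI u)) (exist _ r Ir).
  pose g i := G (Y i).
  apply: (osc (fun i => g i * h * (g i)^-1) (fun i => g i l) (fun i => g i r)
    (fun i => f (g i))).
  - apply: monotone_disjoint => i; first by rewrite aut_le ltW.
    by have [_ /ltW] := GP (Y i.+1).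
  - by move=> i; exact: supported_conj.
  - by move=> i; rewrite -fM mul1g.
  - by move=> i; rewrite -fM mulgVK fM; have [] := GP (Y i).
have pL h l r : I l -> I r -> (l < r)%O -> supported (oo l r) h -> f h * p = p.
  move=> Il Ir lr hlr; apply: contrapT => ph.
  have [|O1 [O2 [oO1 oO2 O1p O2p osc]]] :=
      no_oscillation (act := fun b c => c * b) (@cont_mull) (@cont_mulr) _ ph.
    by move=> g k b ->; rewrite fM mulgA.
  have /choice[G GP] (y : {y | I y}) : exists g, [/\ supported I g,
      (r < g (sval y))%O, O1 (f h * f g) & O2 (f g)].
    case: y => y /= Iy; have [_ [[g [gI yg] <-] [O1g O2g]]] := pP y r Iy Ir _
      (filterI (nbhs_preimage (@cont_mulr (f h)) oO1 O1p)
               (open_nbhs_nbhs (conj oO2 O2p))).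
    by exists g.
  have GI u : I ((G u)^-1 l).
    by apply: supported_mem => //; apply: supportedV; have [] := GP u.
  (* Now the preimages of the interval from [l] to [r] move to the left, and right multiplication
     turns [f (g i)] into [f h * f (g i)]. *)
  pose Y i := iter i (fun u => exist _ ((G u)^-1 l) (GI u)) (exist _ l Il).
  pose g i := G (Y i).
  apply: (osc (fun i => (g i)^-1 * h * ((g i)^-1)^-1) (fun i => (g i)^-1 l)
    (fun i => (g i)^-1 r) (fun i => f (g i))).
  - apply: antitone_disjoint => i; first by rewrite aut_le ltW.
    rewrite -(aut_le (g i.+1)) autVK.
    by have [_ /ltW] := GP (Y i.+1).
  - by move=> i; exact: supported_conj.
  - by move=> i; rewrite -fM mulg1.
  - by move=> i; rewrite invgK -fM !mulgA mulgV mul1g fM; have [] := GP (Y i).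
(* So far only automorphisms of bounded support are absorbed; they are dense among those supported
   in [I]. *)
pose bounded := [set k | exists l r, [/\ I l, I r, (l < r)%O & supported (oo l r) k]].
have bdense h : supported I h -> closure (f @` bounded) (f h).
  move=> hI B /f_continuous /(supported_bounded_dense Io hI).
  move=> [l [r [k [Il Ir lr klr Bk]]]]; exists (f k); split=> //.
  by exists k => //; exists l, r.
exists p; split; last first.
  move=> h /bdense hb; split.
    apply: (closure_eq_fun S_compact S_hausdorff (@cont_mull p) (@cont_cst p) hb).
    by move=> _ [k [l [r [Il Ir lr klr]]] <-]; exact: pL klr.
  apply: (closure_eq_fun S_compact S_hausdorff (@cont_mulr p) (@cont_cst p) hb).
  by move=> _ [k [l [r [Il Ir lr klr]]] <-]; exact: pR klr.
by apply: closureS (pP a a Ia Ia); apply: image_subset => g [].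
Qed.

Lemma zero_mul I b (e1 e2 : S) : open_convex I -> I b ->
  is_zero (below I b) e1 -> is_zero (above I b) e2 -> is_zero I (e1 * e2).
Proof.
move=> Io Ib z1 z2; set e := e1 * e2.
have belowI : below I b `<=` I by move=> x [].
have aboveI : above I b `<=` I by move=> x [].
have Ie : closure (f @` [set g | supported I g]) e.
  apply: closure_mul (proj1 z1) (proj1 z2) _ => g h gI hI.
  by apply: supportedM; [apply: supportedS gI|apply: supportedS hI].
have gh_comm g h : supported (below I b) g -> supported (above I b) h ->
    g * h = h * g.
  move=> gI hI; apply: order_aut_eq => x.
  rewrite -[(g * h) x]/(g (h x)) -[(h * g) x]/(h (g x)).
  have [xb|bx] := ltP x b.
    have gxb : (g x < b)%O.
      have [/(supported_mem gI)[]//|nx] := pselect (below I b x).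
      by rewrite gI.
    by rewrite (hI x) ?(hI (g x))// => -[_] /=; rewrite ltNge ltW.
  have bhx : (b <= h x)%O.
    have [/(supported_mem hI)[_ /ltW]//|nx] := pselect (above I b x).
    by rewrite hI.
  by rewrite (gI x) ?(gI (h x))// => -[_] /=; rewrite ltNge ?bx ?bhx.
have e1_comm h : supported (above I b) h -> f h * e1 = e1 * f h.
  move=> hI; apply: (closure_eq_fun S_compact S_hausdorff
    (@cont_mulr (f h)) (@cont_mull (f h)) (proj1 z1)).
  by move=> _ [g gI <-]; rewrite -!fM (gh_comm g h).
have e2_comm g : supported (below I b) g -> f g * e2 = e2 * f g.
  move=> gI; apply: (closure_eq_fun S_compact S_hausdorff
    (@cont_mulr (f g)) (@cont_mull (f g)) (proj1 z2)).
  by move=> _ [h hI <-]; rewrite -!fM (gh_comm g h).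
have e12 : e2 * e1 = e1 * e2.
  apply: (closure_eq_fun S_compact S_hausdorff
    (@cont_mull e1) (@cont_mulr e1) (proj1 z2)).
  by move=> _ [h hI <-]; exact: e1_comm.
have ee : e * e = e.
  rewrite /e mulgA -(mulgA e1) e12 mulgA (zero_absorb z1 (proj1 z1)).1.
  by rewrite -mulgA (zero_absorb z2 (proj1 z2)).1.
(* Such a [k] splits at [b] into a factor absorbed by [e1] and one absorbed by [e2]. *)
have e_fix k : supported I k -> k b = b -> f k * e = e /\ e * f k = e.
  move=> kI kb; have [k1 [k1l k1r]] := @order_aut_glue _ _ k 1 b kb.
  have [k2 [k2l k2r]] := @order_aut_glue _ _ 1 k b (esym kb).
  have k1I : supported (below I b) k1.
    move=> x nx; have [bx|xb] := leP b x; first by rewrite k1r.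
    by rewrite k1l ?ltW// kI// => Ix; apply: nx.
  have k2I : supported (above I b) k2.
    move=> x nx; have [xb|bx] := leP x b; first by rewrite k2l.
    by rewrite k2r ?ltW// kI// => Ix; apply: nx.
  have kE : k = k1 * k2.
    apply: order_aut_eq => x; rewrite -[(k1 * k2) x]/(k1 (k2 x)).
    have [xb|bx] := leP x b; first by rewrite k2l// k1l.
    by rewrite k2r ?ltW// k1r// -kb aut_le ltW.
  have [k1e1 e1k1] := proj2 z1 _ k1I; have [k2e2 e2k2] := proj2 z2 _ k2I.
  rewrite kE fM; split.
    by rewrite /e -mulgA (mulgA (f k2)) e1_comm// -mulgA k2e2 mulgA k1e1.
  by rewrite /e mulgA -(mulgA e1) -e2_comm// mulgA e1k1 -mulgA e2k2.
clearbody e.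
have sandwich g : supported I g -> e * f g * e = e.
  move=> gI; have [gb|/eqP gb] := pselect (g b = b).
    by rewrite (e_fix g gI gb).2.
  (* Take [b'] close to [b] on the side of [g b], [v] moving [b] to [b'], and [h] fixing [b] and
     taking [b'] to [g b]. Then [v^-1 * (h^-1 * g)] fixes [b], and [e] absorbs it as well as [h]. *)
  have near1 V : nbhs (1 : order_aut X) V ->
      exists2 v, V v & e * f v * e = e * f g * e.
    move=> /(order_aut_nbhs1_oo b)[l [r [/andP[lb br] lrV]]].
    have Igb : I (g b) := supported_mem gI Ib.
    have [a Ia [ab _]] := open_convex_lt2 Io Ib Ib.
    have [c Ic [bc _]] := open_convex_gt2 Io Ib Ib.
    (* Clipping by [a] and [c] keeps the support of [v] inside [I]. *)
    pose l' := Order.max l a; pose r' := Order.min r c.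
    have lb' : (l' < b)%O by rewrite gt_max lb ab.
    have br' : (b < r')%O by rewrite lt_min br bc.
    have [b' [h [lbr' hI hb hb']]] : exists b' h, [/\ (l' < b' < r')%O,
        supported I h, h b = b & h b' = g b].
      have [bgb|gbb|gbE] := ltgtP b (g b); last by rewrite -gbE eqxx in gb.
        have [b' /andP[bb' b'r]] := uh_dense br'.
        have [hi' Ihi' [b'hi' gbhi']] : exists2 z, I z & (b' < z)%O /\ (g b < z)%O.
          apply: open_convex_gt2 => //; case: Io => _ Ic' _ _.
          apply: Ic' Ib Ic _; rewrite !ltW//.
          by move: b'r; rewrite lt_min => /andP[].
        have [||h hs hb'] := @supported_transitive b hi' b' (g b).
        - by rewrite bb'.
        - by rewrite bgb.
        exists b', h; split=> //; first by rewrite b'r (lt_trans lb').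
          by apply: supportedS hs; exact: oo_sub.
        by rewrite hs// /oo /= ltxx.
      have [b' /andP[lb'' b'b]] := uh_dense lb'.
      have [lo' Ilo' [lo'b' lo'gb]] : exists2 z, I z & (z < b')%O /\ (z < g b)%O.
        apply: open_convex_lt2 => //; case: Io => _ Ic' _ _.
        apply: Ic' Ia Ib _; rewrite !ltW//.
        by move: lb''; rewrite gt_max => /andP[].
      have [||h hs hb'] := @supported_transitive lo' b b' (g b).
      - by rewrite lo'b'.
      - by rewrite lo'gb.
      exists b', h; split=> //; first by rewrite lb'' (lt_trans b'b).
        by apply: supportedS hs; exact: oo_sub.
      by rewrite hs// /oo /= ltxx andbF.
    have [|//|v vs vb] := @supported_transitive l' r' b b'; first by rewrite lb'.
    have vI : supported I v.
      apply: supportedS vs => x /andP[]; rewrite gt_max lt_min.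
      move=> /andP[_ ax] /andP[_ xc]; apply: (oo_sub Io Ia Ic).
      by rewrite /oo /= ax.
    exists v.
      apply: lrV; apply: supportedS vs => x /andP[]; rewrite gt_max lt_min.
      by move=> /andP[lx _] /andP[xr _]; rewrite /oo /= lx.
    have [k [kI kb ->]] : exists k, [/\ supported I k, k b = b & g = h * (v * k)].
      exists (v^-1 * (h^-1 * g)); split; last by rewrite !mulVKg.
        by apply: supportedM; [|apply: supportedM] => //; exact: supportedV.
      by rewrite -[LHS]/(v^-1 (h^-1 (g b))) -hb' autK -vb autK.
    by rewrite !fM !mulgA (e_fix h hI hb).2 -(mulgA _ (f k)) (e_fix k kI kb).1.
  (* By [near1], the value [e * f g * e] is attained arbitrarily close to [1], where continuity
     forces the value [e * f 1 * e = e]. *)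
  apply: contrapT => ege.
  have cont : continuous (fun v => e * f v * e).
    move=> v; apply: (@continuous_comp _ _ _ (fun v => e * f v) (fun a : S => a * e));
      last exact: mulg_continuousl.
    apply: (@continuous_comp _ _ _ f (fun a : S => e * a)); first exact: f_continuous.
    exact: mulg_continuousr.
  have := hausdorff_accessible S_hausdorff.
  move=> /(_ (e * f 1 * e) (e * f g * e)); case.
    by apply/eqP; rewrite (e_fix 1 (@supported1 _ _ _) erefl).2 ee => /esym.
  move=> O [oO /set_mem O1 /set_mem Og].
  have [v Ov vg] := near1 _ (nbhs_preimage cont oO O1).
  by apply: Og; rewrite -vg.
(* The sandwich identity passes to the limit [z], and [z] absorbs [e]: thus [e = e * z * e = z]. *)
have [z zI] := exists_zero Io.
suff -> : e = z by [].
have [ez ze] := zero_absorb zI Ie.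
have cont : continuous (fun a : S => e * a * e).
  move=> a; apply: (@continuous_comp _ _ _ (fun a : S => e * a) (fun a : S => a * e)).
    exact: mulg_continuousr.
  exact: mulg_continuousl.
have <- : e * z * e = e.
  apply: (closure_eq_fun S_compact S_hausdorff cont (@cont_cst e) (proj1 zI)).
  by move=> _ [g gI <-]; exact: sandwich.
by rewrite ez ze.
Qed.

(** Induction on [s] for all [I] at once. A point outside [I] is fixed anyway; at a point of [I] the
    zero is the product of the zeros of the two halves. *)
Lemma zero_closure_fix (s : seq X) I (e : S) : open_convex I -> is_zero I e ->
  closure (f @` [set g | supported I g /\ forall x, x \in s -> g x = x]) e.
Proof.
elim: s I e => [|x s IHs] I e Io ze.
  by apply: closureS (proj1 ze); apply: image_subset.
have [Ix|nIx] := pselect (I x); last first.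
  apply: closureS (IHs I e Io ze); apply: image_subset => g [gI gs].
  by split => // y /[!inE] /predU1P[->|/gs//]; exact: gI.
have belowI := open_convex_below Io Ix; have aboveI := open_convex_above Io Ix.
have [e1 z1] := exists_zero belowI; have [e2 z2] := exists_zero aboveI.
rewrite (zero_unique ze (zero_mul Io Ix z1 z2)).
apply: closure_mul (IHs _ _ belowI z1) (IHs _ _ aboveI z2) _.
move=> g h [gI gs] [hI hs]; split.
  by apply: supportedM; [apply: supportedS gI|apply: supportedS hI] => y [].
move=> y /[!inE] /predU1P[->|ys]; rewrite -[(g * h) _]/(g (h _)).
  by rewrite (hI x) ?(gI x)// => -[_ /=]; rewrite ltxx.
by rewrite hs// gs.
Qed.

Lemma order_aut_morph_const g : f g = f 1.
Proof.
have [e ze] := exists_zero open_convexT.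
(* By continuity [f] maps the stabiliser of some finite set into [O2], while [e] lies in the closure
   of its image. *)
have e1 : e = f 1.
  apply: contrapT => /(separating_opens S_compact S_hausdorff).
  move=> [O1 [O2 [N1 [N2 [W [[O1e O2f] [oO1 oO2 _ _ _] O1N [O2W WN] N12]]]]]].
  have /order_aut_nbhs_seq[s sO] := nbhs_preimage f_continuous oO2 O2f.
  have [_ [[k [_ ks] <-] O1k]] :=
    zero_closure_fix s open_convexT ze (open_nbhs_nbhs (conj oO1 O1e)).
  have : (N1 `&` N2) (f k).
    split; first by apply: O1N; exact: subset_closure.
    apply: WN; apply: subset_closure; apply: O2W; apply: subset_closure.
    by apply: sO => x /ks.
  by rewrite N12.
have [ge _] : f g * e = e /\ e * f g = e by apply: (proj2 ze) => x; case.
by rewrite -e1 -ge e1 -fM mulg1.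
Qed.

End Constant.
End Homogeneous.

(** * The one-point monoid and the conclusion *)

Definition trivial_monoid : Type := unit.

HB.instance Definition _ := Choice.on trivial_monoid.

HB.instance Definition _ := @isMonoid.Build trivial_monoid
  (fun _ _ => tt) tt (fun _ _ _ => erefl)
  (fun x => match x with tt => erefl end) (fun x => match x with tt => erefl end).

HB.instance Definition _ := @isOpenTopological.Build trivial_monoid
  (fun=> True) I (fun _ _ _ _ => I) (fun _ _ _ => I).

Lemma trivial_mulr (a : trivial_monoid) : continuous (fun x : trivial_monoid => a * x).
Proof. exact: (@cst_continuous trivial_monoid trivial_monoid tt). Qed.

Lemma trivial_mull (a : trivial_monoid) : continuous (fun x : trivial_monoid => x * a).
Proof. exact: (@cst_continuous trivial_monoid trivial_monoid tt). Qed.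

HB.instance Definition _ :=
  PreTopologicalSemigroup_isSemitopological.Build trivial_monoid
    trivial_mulr trivial_mull.

Theorem theorem5p10 (d : Order.disp_t) (X : orderTopologicalType d)
    (X_infinite : infinite_set [set: X]%classic)
    (X_uh : ultrahomogeneous X) :
  (forall (K : semitopologicalMonoidType) (b : order_aut X -> K),
     ~ sm_compactification b) /\
  wap_trivial (order_aut X).
Proof.
have const (S : semitopologicalSemigroupType) (f : order_aut X -> S) :
    compact [set: S] -> hausdorff_space S -> continuous f ->
    {morph f : g h / g * h} -> forall g, f g = f 1.
  move=> cS hS cf fM; exact: order_aut_morph_const.
split=> [K b [[cK hK [cb b_inj _] _] _ bM]|].
  (* An injective [b] cannot be constant, since some automorphism moves a point. *)
  have bE := const K b cK hK cb (fun g h => esym (bM g h)).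
  have [x [y xy]] := exists_lt X_infinite.
  have [//|//|//|g [gx]] := @uh_seq _ _ X_uh [:: x] [:: y].
  have g1 : g = 1 by apply: b_inj; rewrite bE.
  by move: xy; rewrite -gx g1 ltxx.
have compactT : compact [set: trivial_monoid].
  by move=> F FF _; exists tt; split=> // A B FA /nbhs_singleton Bt;
     have [[] At] := filter_ex FA; exists tt.
split; last first.
  (* The image of [w] is [1] alone and is dense in a Hausdorff space. *)
  move=> W w [cW hW cw w1 wM wD _]; exists 1.
  apply/seteqP; split=> // p _ /=; apply: (hW) => A B /nbhs_interior Ap Bq.
  have [q [Aq [g _ wg]]] := wD _ (ex_intro _ p (nbhs_singleton Ap)) (open_interior A).
  exists 1; split; last exact: nbhs_singleton.
  by apply: interior_subset; rewrite -w1 -(const _ w cW hW cw wM g) wg.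
exists trivial_monoid, (fun=> tt); split=> //.
- by move=> [] [].
- exact: cst_continuous.
- by move=> O [[] Ott] _; exists tt; split=> //; exists 1.
- move=> S f cS hS cf fM; have fE := const S f cS hS cf fM.
  (* [f 1] is idempotent, so the constant map is a homomorphism. *)
  exists (fun=> f 1); split=> [|_ _|g].
  + exact: cst_continuous.
  + by rewrite -fM mulg1.
  + by rewrite fE.
Qed.
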